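(* Let $\mathbb{G}$ be a finite quantum group with Haar element $\eta$, and let $\nu\in M_p(\mathbb{G})$ be such that $\nu(\eta)>0$. Then the convolution powers $(\nu^{\star k})_{k\geq 1}$ converge.
   Context: A finite quantum group $\mathbb{G}$ is given by its algebra of functions $F(\mathbb{G})$: a finite-dimensional unital $\mathrm{C}^*$-algebra with a $*$-homomorphism (comultiplication) $\Delta:F(\mathbb{G})\to F(\mathbb{G})\otimes F(\mathbb{G})$, a counit $\varepsilon$ and an antipode $S$ making $(F(\mathbb{G}),\Delta,S,\varepsilon)$ a Hopf $*$-algebra. $M_p(\mathbb{G})$ denotes the set of states on $F(\mathbb{G})$ (positive linear functionals taking the value $1$ at the unit). The convolution powers of $\nu\in M_p(\mathbb{G})$ are $\nu^{\star 1}=\nu$, $\nu^{\star(k+1)}=(\nu\otimes\nu^{\star k})\circ\Delta$; convergence is in the finite-dimensional dual space $F(\mathbb{G})^*$. Since the counit $\varepsilon:F(\mathbb{G})\to\mathbb{C}$ is a character, the multi-matrix algebra $F(\mathbb{G})$ has a one-dimensional factor $\mathbb{C}\eta$ with $F(\mathbb{G})=\mathbb{C}\eta\oplus\ker\varepsilon$; the Haar element $\eta$ is the central projection spanning this factor, so $\varepsilon(\eta)=1$ and $f\eta=\varepsilon(f)\eta=\eta f$ for all $f\in F(\mathbb{G})$. It equals the support projection $p_\varepsilon$ of the counit, i.e. the smallest projection $p$ with $\varepsilon(p)=1$. *)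

(* Defs.v *)
From HB Require Import structures.
From mathcomp Require Import all_boot all_order all_algebra all_field.
From mathcomp Require Import complex.
From mathcomp Require Import boolp classical_sets reals topology normedtype.

Set Implicit Arguments.
Unset Strict Implicit.
Unset Printing Implicit Defensive.

Import Order.TTheory GRing.Theory Num.Theory.
Import numFieldNormedType.Exports.

Local Open Scope ring_scope.
Local Open Scope complex_scope.
Local Open Scope classical_set_scope.

(* The tensor product of A and B, represented by coordinates in the product   *)
(* of the bases vbasis fullv; tlift_pure and tens_ext below are its universal *)
(* property: tlift b is the only linear map with tlift b (x *t y) = b x y.    *)
Definition tens (K : fieldType) (A B : vectType K) : Type :=
  'M[K]_(\dim {:A}, \dim {:B}).

HB.instance Definition _ (K : fieldType) (A B : vectType K) :=
  Vector.copy (tens A B) 'M[K]_(\dim {:A}, \dim {:B}).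

Section TensorSpace.
Variable K : fieldType.
Implicit Types A B V : vectType K.

Definition pure A B (x : A) (y : B) : tens A B :=
  \matrix_(i, j) (coord (vbasis {:A}) i x * coord (vbasis {:B}) j y).

Notation "x *t y" := (pure x y) (at level 40, left associativity) : ring_scope.

Definition tlift A B (V : lmodType K) (b : A -> B -> V) (X : tens A B) : V :=
  \sum_i \sum_j (X : 'M_(_, _)) i j *: b (vbasis {:A})`_i (vbasis {:B})`_j.

Fact tlift_is_linear A B (V : lmodType K) (b : A -> B -> V) : linear (tlift b).
Proof.
move=> c X Y; rewrite /tlift scaler_sumr -big_split; apply: eq_bigr => i _ /=.
rewrite scaler_sumr -big_split; apply: eq_bigr => j _ /=.
by rewrite !mxE scalerDl scalerA.
Qed.
HB.instance Definition _ A B (V : lmodType K) (b : A -> B -> V) :=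
  GRing.isLinear.Build K (tens A B) V *:%R (tlift b) (@tlift_is_linear A B V b).

Lemma pure_linearl A B (y : B) : linear (fun x : A => pure x y).
Proof.
by move=> c x x'; apply/matrixP => i j; rewrite !mxE linearP mulrDl mulrA.
Qed.

Lemma pure_linearr A B (x : A) : linear (pure x : B -> tens A B).
Proof.
by move=> c y y'; apply/matrixP => i j; rewrite !mxE linearP mulrDr mulrCA.
Qed.

Lemma tlift_pure A B (V : lmodType K) (b : A -> B -> V) x y :
    (forall y', linear (b^~ y')) -> (forall x', linear (b x')) ->
  tlift b (x *t y) = b x y.
Proof.
move=> bl br.
pose bl' y' : {linear A -> V} :=
  HB.pack (b^~ y') (GRing.isLinear.Build _ _ _ _ _ (bl y')).
pose br' x' : {linear B -> V} :=
  HB.pack (b x') (GRing.isLinear.Build _ _ _ _ _ (br x')).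
rewrite [RHS](_ : _ = bl' y x) // [in RHS](coord_vbasis (memvf x)) linear_sum.
apply: eq_bigr => i _; rewrite linearZ [bl' y _](_ : _ = br' (vbasis {:A})`_i y) //.
rewrite [in RHS](coord_vbasis (memvf y)) linear_sum.
rewrite /= scaler_sumr.
by apply: eq_bigr => j _; rewrite [b _ (_ *: _)](linearZZ (br' _)) scalerA mxE.
Qed.

Lemma tens_expand A B (X : tens A B) : X = tlift (@pure A B) X.
Proof.
apply/matrixP => k l; rewrite /tlift summxE (bigD1 k) //= summxE (bigD1 l) //=.
have cE (U : vectType K) (i j : 'I_(\dim {:U})) :
    coord (vbasis {:U}) i (vbasis {:U})`_j = (i == j)%:R.
  by rewrite coord_free ?(basis_free (vbasisP _)) // eq_sym.
rewrite !mxE !cE !eqxx !mulr1 !big1 ?addr0 //.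
- move=> i ik; rewrite summxE big1 // => j _.
  by rewrite !mxE !cE eq_sym (negPf ik) mul0r mulr0.
- by move=> j jl; rewrite !mxE !cE [l == j]eq_sym (negPf jl) !mulr0.
Qed.

Lemma tens_ext A B (V : lmodType K) (f g : tens A B -> V) :
    linear f -> linear g -> (forall x y, f (x *t y) = g (x *t y)) -> f =1 g.
Proof.
move=> fl gl fg X.
pose f' : {linear tens A B -> V} :=
  HB.pack f (GRing.isLinear.Build _ _ _ _ _ fl).
pose g' : {linear tens A B -> V} :=
  HB.pack g (GRing.isLinear.Build _ _ _ _ _ gl).
change (f' X = g' X); rewrite [X]tens_expand /tlift !linear_sum.
apply: eq_bigr => i _; rewrite !linear_sum; apply: eq_bigr => j _.
by rewrite !linearZ /= fg.
Qed.

Lemma tlift_linear A B (U V : lmodType K) (b : A -> B -> U -> V) X :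
  (forall x y, linear (b x y)) -> linear (fun u => tlift (fun x y => b x y u) X).
Proof.
move=> bl c u v; rewrite /tlift scaler_sumr -big_split; apply: eq_bigr => i _ /=.
rewrite scaler_sumr -big_split; apply: eq_bigr => j _ /=.
by rewrite bl scalerDr !scalerA [c * _]mulrC.
Qed.

End TensorSpace.

Notation "x *t y" := (pure x y) (at level 40, left associativity) : ring_scope.


Definition tmap (K : fieldType) (A B A' B' : vectType K)
    (f : A -> A') (g : B -> B') : tens A B -> tens A' B' :=
  tlift (fun x y => f x *t g y).

Definition tassoc (K : fieldType) (A B C : vectType K) :
    tens (tens A B) C -> tens A (tens B C) :=
  tlift (fun X z => tlift (fun x y => x *t (y *t z)) X).

Section TensorAlgebra.
Variables (K : fieldType) (A B : falgType K).
Implicit Types X Y Z : tens A B.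

Definition tmul X Y : tens A B :=
  tlift (fun x y => tlift (fun x' y' => (x * x') *t (y * y')) Y) X.

Fact tmul_linearl Y : linear (tmul^~ Y).
Proof. exact: linearP. Qed.

Fact tmul_linearr X : linear (tmul X).
Proof.
by apply: (tlift_linear (b := fun x y Y => tlift _ Y)) => x y; exact: linearP.
Qed.

Lemma tmul_pure (x x' : A) (y y' : B) :
  tmul (x *t y) (x' *t y') = (x * x') *t (y * y').
Proof.
rewrite /tmul tlift_pure.
- rewrite tlift_pure // => [y''|x''] c u v.
  + by rewrite mulrDr -scalerAr pure_linearl.
  + by rewrite mulrDr -scalerAr pure_linearr.
- move=> z; apply: (tlift_linear (b := fun a b u => (u * a) *t (z * b))).
  by move=> x'' y'' c u v; rewrite mulrDl -scalerAl pure_linearl.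
- move=> z; apply: (tlift_linear (b := fun a b u => (z * a) *t (u * b))).
  by move=> x'' y'' c u v; rewrite mulrDl -scalerAl pure_linearr.
Qed.

Fact tmulA : associative tmul.
Proof.
move=> X Y Z.
apply: (tens_ext (f := tmul^~ (tmul Y Z)) (g := fun X => tmul (tmul X Y) Z)).
- exact: tmul_linearl.
- by move=> c X1 X2; rewrite !tmul_linearl.
move=> x y.
apply: (tens_ext (f := fun Y => tmul _ (tmul Y Z)) (g := fun Y => tmul (tmul _ Y) Z)).
- by move=> c Y1 Y2; rewrite tmul_linearl tmul_linearr.
- by move=> c Y1 Y2; rewrite tmul_linearr tmul_linearl.
move=> x' y'.
apply: (tens_ext (f := fun Z => tmul _ (tmul _ Z)) (g := tmul _)).
- by move=> c Z1 Z2; rewrite !tmul_linearr.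
- by move=> c Z1 Z2; rewrite tmul_linearr.
by move=> x'' y''; rewrite !tmul_pure !mulrA.
Qed.

Fact tmul1 : left_id (1 *t 1) tmul.
Proof.
apply: (tens_ext (g := id)); [exact: tmul_linearr | by [] | move=> x y].
by rewrite tmul_pure !mul1r.
Qed.

Fact tmulr1 : right_id (1 *t 1) tmul.
Proof.
apply: (tens_ext (g := id)); [exact: tmul_linearl | by [] | move=> x y].
by rewrite tmul_pure !mulr1.
Qed.

Fact tmulDl : left_distributive tmul +%R.
Proof. by move=> X Y Z; have := tmul_linearl Z 1 X Y; rewrite !scale1r. Qed.

Fact tmulDr : right_distributive tmul +%R.
Proof. by move=> X Y Z; have := tmul_linearr X 1 Y Z; rewrite !scale1r. Qed.

Fact tone_neq0 : 1 *t 1 != 0 :> tens A B.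
Proof.
have nz (C : falgType K) : exists i, coord (vbasis {:C}) i 1 != 0.
  apply/existsP; apply: contraT => /existsPn c0.
  have := oner_neq0 C; rewrite {1}(coord_vbasis (memvf (1 : C))) big1 ?eqxx //.
  by move=> i _; move: (c0 i); rewrite negbK => /eqP ->; rewrite scale0r.
have [[i Ai] [j Bj]] := (nz A, nz B).
apply/eqP => /matrixP/(_ i j); rewrite !mxE => /eqP.
by rewrite mulf_eq0 (negPf Ai) (negPf Bj).
Qed.

HB.instance Definition _ := GRing.Zmodule_isNzRing.Build (tens A B)
  tmulA tmul1 tmulr1 tmulDl tmulDr tone_neq0.

Fact tscalerAl (c : K) X Y : c *: (X * Y) = (c *: X) * Y.
Proof. by have := tmul_linearl Y c X 0; rewrite addr0 -[tmul 0 Y]/(0 * Y) mul0r addr0. Qed.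
HB.instance Definition _ := GRing.Lmodule_isLalgebra.Build K (tens A B) tscalerAl.

Fact tscalerAr (c : K) X Y : c *: (X * Y) = X * (c *: Y).
Proof. by have := tmul_linearr X c Y 0; rewrite addr0 -[tmul X 0]/(X * 0) mulr0 addr0. Qed.
HB.instance Definition _ := GRing.Lalgebra_isAlgebra.Build K (tens A B) tscalerAr.

HB.instance Definition _ := Algebra_isFalgebra.Build K (tens A B).

Lemma tensM (x x' : A) (y y' : B) :
  (x *t y) * (x' *t y') = (x * x') *t (y * y').
Proof. exact: tmul_pure. Qed.

Lemma tens1 : 1 = 1 *t 1 :> tens A B.
Proof. by []. Qed.

End TensorAlgebra.

(* Completeness of the norm is automatic in finite dimension. *)
Record finCstarAlg (R : realType) := FinCstarAlg {
  cstar_sort :> falgType R[i];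
  star : cstar_sort -> cstar_sort;
  cnorm : cstar_sort -> R;
  star_antilinear : forall (c : R[i]) x y,
    star (c *: x + y) = c^*%C *: star x + star y;
  starK : involutive star;
  starM : forall x y, star (x * y) = star y * star x;
  cnorm_eq0 : forall x, cnorm x = 0 -> x = 0;
  cnormZ : forall (c : R[i]) x, (cnorm (c *: x))%:C = `|c| * (cnorm x)%:C;
  cnormD : forall x y, cnorm (x + y) <= cnorm x + cnorm y;
  cnormM : forall x y, cnorm (x * y) <= cnorm x * cnorm y;
  cnorm_star : forall x, cnorm (star x * x) = cnorm x ^+ 2
}.

Section TensorStar.
Variable R : realType.
Implicit Types A B : finCstarAlg R.

Lemma starD A : {morph @star R A : x y / x + y}.
Proof. by move=> x y; have := star_antilinear 1 x y; rewrite rmorph1 !scale1r. Qed.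

Lemma star0 A : star (0 : A) = 0.
Proof. by apply: (addIr (star 0)); rewrite -starD !add0r. Qed.

Lemma starZ A (c : R[i]) (x : A) : star (c *: x) = c^*%C *: star x.
Proof. by have := star_antilinear c x 0; rewrite star0 !addr0. Qed.

(* The coordinates are conjugated because star is antilinear. *)
Definition tstar A B (X : tens A B) : tens A B :=
  tlift (fun x y => star x *t star y) (map_mx conjc (X : 'M_(_, _)) : tens A B).

Lemma tstar_pure A B (x : A) (y : B) : tstar (x *t y) = star x *t star y.
Proof.
rewrite [in RHS](coord_vbasis (memvf x)) [in RHS](coord_vbasis (memvf y)).
rewrite !(big_morph _ (@starD _) (@star0 _)).
pose pl z := HB.pack_for {linear A -> tens A B} ((@pure _ A B)^~ z)
  (GRing.isLinear.Build _ _ _ _ _ (pure_linearl z)).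
pose pr z := HB.pack_for {linear B -> tens A B} (@pure _ A B z)
  (GRing.isLinear.Build _ _ _ _ _ (pure_linearr z)).
rewrite [RHS](linear_sum (pl _)); apply: eq_bigr => i _.
rewrite [RHS](linear_sum (pr _)); apply: eq_bigr => j _.
rewrite !starZ [RHS](linearZZ (pl _)) /= [X in _ = _ *: X](linearZZ (pr _)) /=.
by rewrite !mxE rmorphM scalerA.
Qed.

End TensorStar.

Record finQuantumGroup (R : realType) := FinQuantumGroup {
  fun_alg :> finCstarAlg R;
  comult : {lrmorphism fun_alg -> tens fun_alg fun_alg};
  counit : {lrmorphism fun_alg -> R[i] | *%R};
  antipode : {linear fun_alg -> fun_alg};
  comult_star : forall f, comult (star f) = tstar (comult f);
  comultA : forall f,
    tassoc (tmap comult idfun (comult f)) = tmap idfun comult (comult f);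
  counit_comultl : forall f, tlift (fun x y => counit x *: y) (comult f) = f;
  counit_comultr : forall f, tlift (fun x y => counit y *: x) (comult f) = f;
  antipodel : forall f,
    tlift (fun x y => antipode x * y) (comult f) = counit f *: 1;
  antipoder : forall f,
    tlift (fun x y => x * antipode y) (comult f) = counit f *: 1
}.

Section QuantumGroup.
Variables (R : realType) (G : finQuantumGroup R).
Implicit Types (f eta : G) (mu nu : {scalar G}).

(* haar_central and haar_factor say that the line <[eta]> is a two-sided       *)
(* ideal, so that haar_direct and haar_full make it the one-dimensional       *)
(* factor of F(G) complementary to the kernel of the counit.                  *)
Record is_haar_element eta : Prop := IsHaarElement {
  haar_projection : star eta = eta /\ eta * eta = eta;
  haar_central : forall f, f * eta = eta * f;
  haar_factor : forall f, f * eta \in <[eta]>%VS;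
  haar_direct : directv (<[eta]> + lker (linfun (counit G : G -> R[i]^o)));
  haar_full : (<[eta]> + lker (linfun (counit G : G -> R[i]^o)))%VS = fullv
}.

Lemma haar_counit eta : is_haar_element eta -> counit G eta = 1.
Proof.
case=> -[_ etaK] _ _ _ hfull.
have : counit G eta * counit G eta = 1 * counit G eta.
  by rewrite -rmorphM etaK mul1r.
have [e0 _|enz /(mulIf enz)//] := eqVneq (counit G eta) 0.
have : 1 \in (<[eta]> + lker (linfun (counit G : G -> R[i]^o)))%VS.
  by rewrite hfull memvf.
case/memv_addP => _ /vlineP[c ->] [k]; rewrite memv_ker lfunE /= => /eqP k0.
move/(congr1 (counit G)); rewrite rmorph1 raddfD /= linearZ /= e0 mulr0 add0r k0.
by move/eqP; rewrite oner_eq0.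
Qed.

Lemma haar_absorb eta f : is_haar_element eta -> f * eta = counit G f *: eta.
Proof.
move=> heta; have e1 := haar_counit heta.
have /vlineP[c fE] := haar_factor heta f.
move/(congr1 (counit G)): (fE); rewrite rmorphM linearZ /= e1 !mulr1 => ->.
exact: fE.
Qed.

Definition is_state nu : Prop :=
  (forall f, 0 <= nu (star f * f)) /\ nu 1 = 1.

Definition conv mu nu f : R[i] :=
  tlift (fun x y => mu x * nu y : R[i]^o) (comult G f).

Fact conv_is_linear mu nu : linear_for *%R (conv mu nu).
Proof. by move=> c f g; rewrite /conv !linearP. Qed.
HB.instance Definition _ mu nu :=
  GRing.isLinear.Build R[i] G R[i] *%R (conv mu nu) (conv_is_linear mu nu).

(* By definition of iterop, conv_pow nu 0 is the counit, conv_pow nu 1 is nu  *)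
(* and conv_pow nu k.+2 is conv nu (conv_pow nu k.+1).                        *)
Definition conv_pow nu (k : nat) : {scalar G} :=
  iterop k (fun mu mu' => conv mu mu' : {scalar G}) nu (counit G : {scalar G}).

(* Convergence in F(G)^*: pointwise evaluation defines the only Hausdorff      *)
(* vector space topology on this finite-dimensional space.                    *)
Definition dual_cvg (mu_ : nat -> {scalar G}) mu : Prop :=
  forall f, (mu_ k f : R[i]^o) @[k --> \oo] --> (mu f : R[i]^o).

End QuantumGroup.

(* Main.v *)
Require Import Defs.
From HB Require Import structures.
From mathcomp Require Import all_boot all_order all_algebra all_field.
From mathcomp Require Import spectral sesquilinear.
From mathcomp Require Import complex.
From mathcomp Require Import boolp classical_sets reals topology normedtype.
From mathcomp Require Import ring lra.

(** The hypothesis makes the convolution walk lazy. Since [f * eta] is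
    [counit f *: eta], the functional [nu - nu eta * counit] sends [f] to
    [nu (f * (1 - eta))] and is therefore positive; so for a suitable [0 < c < 1]
    there is a state [psi] with [nu = c * counit + (1 - c) * psi]
    ([state_sub_counit]). Write [T] and [S] for the operators
    [f |-> (nu (x) id) (comult f)] and [f |-> (psi (x) id) (comult f)]. The
    counit axiom gives [T = c + (1 - c) S], and the [k]-th convolution power of
    [nu] is [counit] composed with [T ^ k] ([conv_powE]).

    The functionals [counit o S ^ k] are the convolution powers of [psi], hence
    states ([conv_state]), and the states of a finite-dimensional star-algebra
    are uniformly bounded at every point ([states_bounded]). Expanding
    [T ^ n (1 - T)] by the binomial theorem, the difference of two consecutive
    terms of [counit (T ^ n f)] is at most a constant times the l1-norm of the
    first differences of a binomial distribution, which is O(1 / sqrt n) because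
    the variance of that distribution is O(n) ([lazy_step_tv],
    [lazy_orbit_diff]).

    Vanishing differences imply convergence, because [counit (T ^ n f)] satisfies
    a linear recurrence: a polynomial annihilates [f] under [T]. Dividing out
    the factors [X - 1] of this polynomial one at a time ends with a recurrence
    whose coefficients have nonzero sum, and such a recurrence determines the
    limit ([cvg_orbit]). No spectral information about [T] enters. *)

Set Implicit Arguments.
Unset Strict Implicit.
Unset Printing Implicit Defensive.

Import Order.TTheory GRing.Theory Num.Theory.
Import numFieldNormedType.Exports.

Local Open Scope ring_scope.

(** * Polynomials in an operator, applied to a vector *)

Section OrbitPoly.
Variables (K : comNzRingType) (V : lmodType K) (S : {linear V -> V}) (x : V).

(** The vector [P(S) x]; a sum over iterates keeps it meaningful for an [S] that
    is not an element of an algebra of operators. *)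
Definition orbit_poly (P : {poly K}) : V := \sum_(k < size P) P`_k *: iter k S x.

Lemma orbit_poly_wide n (P : {poly K}) : (size P <= n)%N ->
  orbit_poly P = \sum_(k < n) P`_k *: iter k S x.
Proof.
move=> sPn; rewrite /orbit_poly (big_ord_widen n (fun k => P`_k *: iter k S x)) //.
rewrite big_mkcond; apply: eq_bigr => k _; case: ltnP => // sPk.
by rewrite nth_default // scale0r.
Qed.

Lemma orbit_poly1 : orbit_poly 1 = x.
Proof. by rewrite /orbit_poly size_poly1 big_ord1 coef1 scale1r. Qed.

Lemma orbit_polyD P Q : orbit_poly (P + Q) = orbit_poly P + orbit_poly Q.
Proof.
rewrite !(@orbit_poly_wide (maxn (size P) (size Q)));
  rewrite ?size_polyD ?leq_maxl ?leq_maxr //.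
by rewrite -big_split; apply: eq_bigr => k _; rewrite coefD scalerDl.
Qed.

Lemma orbit_polyZ c P : orbit_poly (c *: P) = c *: orbit_poly P.
Proof.
rewrite (@orbit_poly_wide (size P)) ?size_scale_leq // scaler_sumr.
by apply: eq_bigr => k _; rewrite coefZ scalerA.
Qed.

Lemma orbit_polyX P : orbit_poly (P * 'X) = S (orbit_poly P).
Proof.
rewrite (@orbit_poly_wide (size P).+1); last first.
  by rewrite (leq_trans (size_polyMleq _ _)) // size_polyX addn2.
rewrite big_ord_recl coefMX scale0r add0r linear_sum.
by apply: eq_bigr => k _; rewrite coefMX /= linearZ.
Qed.

End OrbitPoly.

(** * The step distribution of a lazy walk *)

Section LazyStep.
Variables (K : numFieldType) (p : K).

(** The generating polynomial of one step; the coefficients of its [n]-th power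
    are the binomial probabilities with parameters [n] and [p]. *)
Definition lazy_step : {poly K} := (1 - p)%:P + p *: 'X.

Lemma size_lazy_step n : (size (lazy_step ^+ n) <= n.+1)%N.
Proof.
apply: leq_trans (size_poly_exp_leq _ _) _; rewrite ltnS.
have : ((size lazy_step).-1 <= 1)%N.
  have : (size lazy_step <= 2)%N.
    apply: leq_trans (size_polyD _ _) _; rewrite geq_max.
    rewrite (leq_trans (size_polyC_leq1 _)) //.
    by rewrite (leq_trans (size_scale_leq _ _)) // size_polyX.
  by case: (size _) => // -[|[]].
by move=> /(leq_mul (leqnn n)); rewrite muln1 mulnC.
Qed.

Lemma size_lazy_step_diff n : (size (lazy_step ^+ n * (1 - 'X))%R <= n.+2)%N.
Proof.
apply: leq_trans (size_polyMleq _ _) _.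
rewrite -opprB size_polyN size_XsubC addn2 /=.
by rewrite ltnS size_lazy_step.
Qed.

Lemma horner_lazy_step n : (lazy_step ^+ n).[1] = 1.
Proof. by rewrite !hornerE subrK expr1n. Qed.

Lemma lazy_step_ge0 n k : 0 <= p <= 1 -> 0 <= (lazy_step ^+ n)`_k.
Proof.
case/andP=> p0 p1; elim: n k => [|n IHn] k; first by rewrite expr0 coef1 ler0n.
rewrite exprSr mulrDr mulrC coefD coefCM -scalerAr coefZ coefMX.
apply: addr_ge0; first by rewrite mulr_ge0 ?subr_ge0.
by case: ifP => _; rewrite mulr_ge0.
Qed.

(** Writing [Q] for the step polynomial and [N] for [n.+1], this is the
    coefficientwise form of [N p Q ^ N - X (Q ^ N)' = N p (1 - p) Q ^ n (1 - X)],
    which holds because [Q' = p] and [Q - X = (1 - p) (1 - X)]. It turns first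
    differences of binomial probabilities into deviations from the mean. *)
Lemma lazy_step_diff n k :
  n.+1%:R * p * (1 - p) * (lazy_step ^+ n * (1 - 'X))`_k =
  (n.+1%:R * p - k%:R) * (lazy_step ^+ n.+1)`_k.
Proof.
have dL : lazy_step^`() = p%:P.
  by rewrite /lazy_step !derivE add0r -mul_polyC mulr1.
have polyE : (n.+1%:R * p * (1 - p)) *: (lazy_step ^+ n * (1 - 'X)) =
    (n.+1%:R * p) *: lazy_step ^+ n.+1 - (lazy_step ^+ n.+1)^`() * 'X.
  rewrite deriv_exp dL exprS /lazy_step /=.
  rewrite -!mul_polyC -mulr_natl !polyCM polyCB polyC1 polyC_natr.
  ring.
rewrite -coefZ polyE coefB coefZ coefMX coef_deriv.
case: k => [|k] /=; first by rewrite !subr0.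
by rewrite mulrBl -[_ *+ k.+1]mulr_natl.
Qed.

Lemma sum_coef_deriv n (P : {poly K}) : (size P <= n)%N ->
  \sum_(k < n) k%:R * P`_k = P^`().[1].
Proof.
move=> sPn.
have sX : (size (P^`() * 'X)%R <= n)%N.
  have [->|P'0] := eqVneq P^`() 0; first by rewrite mul0r size_poly0.
  rewrite size_mulX //; apply: leq_trans sPn.
  apply: lt_size_deriv; apply: contraNneq P'0 => ->; by rewrite deriv0.
have -> : P^`().[1] = (P^`() * 'X).[1] by rewrite hornerM hornerX mulr1.
rewrite (horner_coef_wide _ sX); apply: eq_bigr => k _.
rewrite expr1n mulr1 coefMX coef_deriv.
by case: k => -[|k] /= _; rewrite ?mul0r // mulr_natl.
Qed.

(** One factor of the square is absorbed by [lazy_step_diff]; the remaining first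
    moment of [Q ^ n (1 - X)] is read off the value and the derivative at [1]. *)
Lemma lazy_step_variance n :
  \sum_(k < n.+2) (n.+1%:R * p - k%:R) ^+ 2 * (lazy_step ^+ n.+1)`_k =
  n.+1%:R * p * (1 - p).
Proof.
set D := lazy_step ^+ n * (1 - 'X).
have sD : (size D <= n.+2)%N := size_lazy_step_diff n.
pose N := n.+1%:R * p; pose v := N * (1 - p).
have D1 : \sum_(k < n.+2) D`_k = 0.
  transitivity D.[1].
    by rewrite (horner_coef_wide _ sD); apply: eq_bigr => k _; rewrite expr1n mulr1.
  by rewrite /D !hornerE subrr mulr0.
have D'1 : D^`().[1] = -1.
  rewrite /D derivM derivB derivX derivC sub0r hornerD !hornerM !hornerN.
  rewrite horner_lazy_step hornerD hornerN !hornerC hornerX.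
  by rewrite subrr mulr0 add0r mul1r.
transitivity (\sum_(k < n.+2) (v * N * D`_k - v * (k%:R * D`_k))).
  apply: eq_bigr => k _; rewrite expr2 -mulrA -lazy_step_diff /v /N -/D; ring.
by rewrite sumrB -!mulr_sumr D1 sum_coef_deriv // D'1 mulr0 sub0r mulrN1 opprK.
Qed.

(** By [lazy_step_diff] the sum is the mean absolute deviation of a binomial
    distribution divided by its variance [v]; Jensen's inequality bounds that
    deviation by the square root of [v]. *)
Lemma lazy_step_tv n : 0 < p < 1 ->
  (\sum_(k < n.+2) `|(lazy_step ^+ n * (1 - 'X))`_k|) ^+ 2
    <= (n.+1%:R * p * (1 - p))^-1.
Proof.
case/andP=> p0 p1.
set v := n.+1%:R * p * (1 - p).
have v0 : 0 < v by rewrite !mulr_gt0 ?ltr0Sn ?subr_gt0.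
pose q k := (lazy_step ^+ n.+1)`_k.
have q0 k : 0 <= q k by apply: lazy_step_ge0; rewrite !ltW.
pose d k : K := n.+1%:R * p - k%:R.
have dR k : d k \is Num.real.
  by rewrite rpredB ?realn // realM ?realn // gtr0_real.
have q1 : \sum_(k < n.+2) q k = 1.
  rewrite -[RHS](horner_lazy_step n.+1) (horner_coef_wide _ (size_lazy_step _)).
  by apply: eq_bigr => k _; rewrite expr1n mulr1.
set m := \sum_(k < n.+2) `|d k| * q k.
have m2 : m ^+ 2 <= v.
  (* The variance of the absolute deviation is nonnegative. *)
  have : 0 <= \sum_(k < n.+2) (`|d k| - m) ^+ 2 * q k.
    apply: sumr_ge0 => k _; rewrite mulr_ge0 // real_exprn_even_ge0 //.
    rewrite realB ?normr_real // sum_real // => i _; rewrite realM ?normr_real //.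
    by rewrite ger0_real.
  rewrite (eq_bigr (fun k : 'I_n.+2 =>
      d k ^+ 2 * q k - (2 * m) * (`|d k| * q k) + m ^+ 2 * q k)).
    rewrite big_split sumrB -!mulr_sumr /= -/m q1 /q /d lazy_step_variance -/v.
    have -> : v - 2 * m * m + m ^+ 2 * 1 = v - m ^+ 2 by ring.
    by rewrite subr_ge0.
  by move=> k _; rewrite -(real_normK (dR k)); ring.
have -> : \sum_(k < n.+2) `|(lazy_step ^+ n * (1 - 'X))`_k| = v^-1 * m.
  rewrite mulr_sumr; apply: eq_bigr => k _; apply: (mulfI (lt0r_neq0 v0)).
  rewrite mulVKf ?lt0r_neq0 // -{1}(gtr0_norm v0) -normrM lazy_step_diff normrM.
  by rewrite [X in _ * X]ger0_norm // -/(q k).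
rewrite exprMn expr2 -mulrA; apply: ler_piMr; first by rewrite invr_ge0 ltW.
by rewrite mulrC ler_pdivrMr // mul1r.
Qed.

End LazyStep.

Section LazyOrbit.
Variables (K : numFieldType) (V : lmodType K) (S T : {linear V -> V}) (p : K).
Hypothesis TE : forall x, T x = (1 - p) *: x + p *: S x.

Lemma lazy_orbit n x : iter n T x = orbit_poly S x (lazy_step p ^+ n).
Proof.
elim: n => [|n IHn]; first by rewrite expr0 orbit_poly1.
rewrite iterS IHn TE exprSr mulrDr orbit_polyD mulrC mul_polyC orbit_polyZ.
by rewrite -scalerAr orbit_polyZ orbit_polyX.
Qed.

(** If [phi] is bounded along the orbit of [S], the value of [phi] along the orbit
    of [T] varies less and less: [T ^ n (1 - T)] is [p Q ^ n (1 - X)] evaluated at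
    [S], so its coefficients are controlled by [lazy_step_tv]. *)
Lemma lazy_orbit_diff (phi : {scalar V}) (r : K) x n : 0 < p < 1 ->
  (forall k, `|phi (iter k S x)| <= r) ->
  `|phi (iter n.+1 T x) - phi (iter n T x)| ^+ 2
    <= (r ^+ 2 * p / (1 - p)) / n.+1%:R.
Proof.
move=> /[dup] p01 /andP[p0 p1] rP.
have r0 : 0 <= r := le_trans (normr_ge0 _) (rP 0).
set D := lazy_step p ^+ n * (1 - 'X).
have sD : (size D <= n.+2)%N := size_lazy_step_diff p n.
have -> : phi (iter n.+1 T x) - phi (iter n T x) = - p * phi (orbit_poly S x D).
  rewrite -raddfB -linearZ /=; congr (phi _).
  rewrite -iterS !lazy_orbit exprSr -orbit_polyZ.
  rewrite -[X in _ - X]scale1r -scaleNr -orbit_polyZ -orbit_polyD; congr orbit_poly.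
  by rewrite /D /lazy_step -!mul_polyC !(polyCN, polyCB, polyC1); ring.
have bound : `|phi (orbit_poly S x D)| <= r * \sum_(k < n.+2) `|D`_k|.
  rewrite (orbit_poly_wide _ _ sD) linear_sum mulr_sumr.
  apply: le_trans (ler_norm_sum _ _ _) _; apply: ler_sum => k _.
  by rewrite linearZ /= normrM mulrC ler_wpM2r.
rewrite normrM exprMn normrN (gtr0_norm p0).
apply: le_trans (_ : _ <= p ^+ 2 * (r ^+ 2 * (n.+1%:R * p * (1 - p))^-1)) _.
  rewrite ler_wpM2l ?exprn_ge0 ?(ltW p0) //.
  apply: le_trans (_ : _ <= (r * \sum_(k < n.+2) `|D`_k|) ^+ 2) _.
    by rewrite lerXn2r // nnegrE // mulr_ge0 // sumr_ge0.
  by rewrite exprMn ler_wpM2l ?exprn_ge0 // lazy_step_tv.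
rewrite le_eqVlt; apply/orP; left; apply/eqP.
field; by rewrite nat1r pnatr_eq0 subr_eq0 [1 == p]eq_sym (lt_eqF p1) lt0r_neq0.
Qed.

End LazyOrbit.

(** * Convergence from a linear recurrence *)

Section Recurrence.
Local Open Scope classical_set_scope.
Variables (K : numFieldType) (W : normedModType K).

Lemma cvg_shift_diff (u : nat -> W) i :
  u n.+1 - u n @[n --> \oo] --> (0 : W) ->
  u (n + i)%N - u n @[n --> \oo] --> (0 : W).
Proof.
move=> du; elim: i => [|i IHi].
  rewrite (@eq_cvg _ _ _ _ (fun=> (0 : W))); first exact: cvg_cst.
  by move=> n; rewrite addn0 subrr.
have E n : u (n + i.+1)%N - u n =
    (u (n + i).+1 - u (n + i)%N) + (u (n + i)%N - u n).
  by rewrite addrA subrK addnS.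
rewrite (eq_cvg _ _ E) -(addr0 (0 : W)).
apply: cvgD IHi.
exact: (cvg_comp _ _ (cvg_addnr i) du).
Qed.

Variables (V : vectType K) (T : {linear V -> V}) (phi : {linear V -> W}) (x : V).

Lemma annihilating_orbit_poly :
  exists2 P : {poly K}, P != 0 & orbit_poly T x P = 0.
Proof.
set d := (\dim {:V}).+1.
pose X := [tuple iter i T x | i < d].
have : ~~ free X.
  by rewrite /free size_tuple neq_ltn ltnS dimvS ?subvf.
move=> /freeP nX.
have [k [kX [i ki]]] : exists k : 'I_d -> K,
    \sum_(i < d) k i *: X`_i = 0 /\ exists i, k i != 0.
  apply: contrapT => nk; apply: nX => k kX i; apply: contrapT => /eqP ki.
  by apply: nk; exists k; split=> //; exists i.
pose P := \poly_(j < d) (k (inord j)).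
have Pk (j : 'I_d) : P`_j = k j by rewrite coef_poly ltn_ord inord_val.
exists P.
  by apply: contraNneq ki => P0; rewrite -Pk P0 coef0.
rewrite (orbit_poly_wide _ _ (size_poly _ _)) -[RHS]kX.
by apply: eq_bigr => j _; rewrite Pk -tnth_nth tnth_mktuple.
Qed.

Hypothesis du : phi (iter n.+1 T x) - phi (iter n T x) @[n --> \oo] --> (0 : W).

(** Consecutive terms being asymptotically equal, all the terms in a linear
    combination of [phi (T ^ (n + i) x)] may be replaced by [phi (T ^ n x)]. *)
Lemma orbit_poly_asymp P :
  phi (iter n T (orbit_poly T x P)) - P.[1] *: phi (iter n T x)
    @[n --> \oo] --> (0 : W).
Proof.
have lim0 : \sum_(i < size P) P`_i *: (phi (iter (n + i) T x) - phi (iter n T x))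
    @[n --> \oo] --> \sum_(i < size P) P`_i *: (0 : W).
  apply: cvg_big => [|i _]; first exact: add_continuous.
  apply: cvgZr; exact: (cvg_shift_diff (u := fun n => phi (iter n T x))).
rewrite big1 in lim0 => [|i _]; last by rewrite scaler0.
apply: cvg_trans lim0; rewrite (_ : (fun n => _) = fun n =>
    \sum_(i < size P) P`_i *: (phi (iter (n + i) T x) - phi (iter n T x))) //.
apply/funext => n; rewrite horner_coef scaler_suml /orbit_poly.
have -> : iter n T (\sum_(k < size P) P`_k *: iter k T x) =
    \sum_(k < size P) P`_k *: iter (n + k) T x.
  elim: n => [|n IHn] //=; rewrite IHn linear_sum.
  by apply: eq_bigr => k _; rewrite linearZ.
rewrite linear_sum -sumrB; apply: eq_bigr => i _.
by rewrite linearZ /= expr1n mulr1 -scalerBr.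
Qed.

(** The recurrence [P(T) x = 0] is weakened to [phi (T ^ n P(T) x)] being constant
    in [n], which makes an induction on [size P] possible. If [P.[1] != 0], then
    [orbit_poly_asymp] gives the limit. Otherwise it shows that the constant is
    zero, and with [P = Q * ('X - 1)] this says that [phi (T ^ n Q(T) x)] is
    constant. *)
Lemma cvg_orbit : exists l : W, phi (iter n T x) @[n --> \oo] --> l.
Proof.
have [P P0 TP] := annihilating_orbit_poly.
have : exists a, forall n, phi (iter n T (orbit_poly T x P)) = a.
  exists 0; elim=> [|n IHn]; rewrite TP ?linear0 //.
  by rewrite iterSr linear0 -TP.
move=> {TP}; have [m] := ubnP (size P); elim: m => // m IHm in P P0 *.
rewrite ltnS => sP [a Pa].
have err := orbit_poly_asymp P.
have [|P1] := eqVneq P.[1] 0; last first.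
  exists (P.[1]^-1 *: (a - 0)).
  have E n : phi (iter n T x) = P.[1]^-1 *:
      (a - (phi (iter n T (orbit_poly T x P)) - P.[1] *: phi (iter n T x))).
    by rewrite Pa opprB addrC subrK scalerA mulVf // scale1r.
  rewrite (eq_cvg _ _ E); apply: cvgZr; apply: cvgB err; exact: cvg_cst.
move=> /eqP /factor_theorem[Q PE].
have Q0 : Q != 0 by apply: contraNneq P0 => Q0; rewrite PE Q0 mul0r.
have a0 : a = 0.
  apply: (@norm_cvg_unique _ W ((fun=> a) @ \oo)); first exact: cvg_cst.
  move: err; rewrite (@eq_cvg _ _ _ _ (fun=> a)) // => n.
  by rewrite Pa PE hornerM hornerXsubC subrr mulr0 scale0r subr0.
apply: (IHm Q) => //.
  by move: sP; rewrite PE size_Mmonic ?monicXsubC // size_XsubC addn2.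
exists (phi (orbit_poly T x Q)); elim=> // n <-.
apply/eqP; rewrite -subr_eq0 -raddfB; apply/eqP; rewrite -[RHS]a0 -(Pa n) PE.
congr (phi _); rewrite mulrBr mulr1 orbit_polyD orbit_polyX.
rewrite -[- Q]scaleN1r orbit_polyZ scaleN1r iterSr.
by elim: n {Pa} => //= n IHn; rewrite -IHn linearB.
Qed.

End Recurrence.

(** * Archimedean estimates for complex numbers *)

Lemma complex_archi (R : realType) (y : R[i]) : 0 <= y -> exists N, y < N%:R.
Proof.
move=> y0; have yE : y = (complex.Re y)%:C%C by apply/esym/RRe_real/ger0_real.
exists (Num.bound (complex.Re y)).
rewrite yE -[X in _ < X](rmorph_nat (real_complex R)) ltcR archi_boundP //.
by rewrite -ler0c -yE.
Qed.

Lemma cvg0_of_sqr_le_harmonic (R : realType) (v : nat -> R[i]) (C : R[i]) :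
  (forall n, `|v n| ^+ 2 <= C / n.+1%:R) ->
  ((v n : R[i]^o) @[n --> \oo] --> (0 : R[i]^o))%classic.
Proof.
move=> vC; apply/cvgr0Pnorm_lt => e e0.
have C0 : 0 <= C.
  by have := vC 0%N; rewrite divr1; apply: le_trans; rewrite exprn_ge0.
have [|N CN] := @complex_archi R (C / e ^+ 2).
  by rewrite divr_ge0 // exprn_ge0 // ltW.
exists N => // n /= Nn.
rewrite -(ltr_pXn2r (ltn0Sn 1)) ?nnegrE ?(ltW e0) //.
apply: le_lt_trans (vC n) _.
rewrite ltr_pdivrMr ?ltr0Sn // mulrC -ltr_pdivrMr ?exprn_gt0 //.
by apply: lt_le_trans CN _; rewrite ler_nat (leq_trans Nn).
Qed.

Lemma bernoulli (K : numDomainType) (x : K) n : 0 <= x -> n%:R * x <= (1 + x) ^+ n.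
Proof.
move=> x0; suff : 1 + n%:R * x <= (1 + x) ^+ n.
  by apply: le_trans; rewrite lerDr.
elim: n => [|n IHn]; first by rewrite mul0r addr0 expr0.
rewrite exprS; apply: le_trans (ler_wpM2l (addr_ge0 ler01 x0) IHn).
rewrite -subr_ge0.
have -> : (1 + x) * (1 + n%:R * x) - (1 + n.+1%:R * x) = n%:R * x ^+ 2 by ring.
by rewrite mulr_ge0 // exprn_ge0.
Qed.

Lemma bounded_powers_le1 (R : realType) (a B : R[i]) : 0 <= a ->
  (forall n, a ^+ (2 ^ n) <= B) -> a <= 1.
Proof.
move=> a0 aB; rewrite real_leNgt ?ger0_real //; apply/negP => a1.
have x0 : 0 < a - 1 by rewrite subr_gt0.
have B0 : 0 <= B := le_trans a0 (aB 0%N).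
have [|n Bn] := @complex_archi R (B / (a - 1)).
  by rewrite divr_ge0 // ltW.
have := aB n; apply/negP.
rewrite -real_ltNge ?ger0_real ?exprn_ge0 //.
have := bernoulli (2 ^ n) (ltW x0); rewrite [1 + _]addrC subrK; apply: lt_le_trans.
rewrite -ltr_pdivrMr //; apply: lt_le_trans Bn _.
by rewrite ler_nat ltnW // ltn_expl.
Qed.

(** * Uniform bounds for states *)

Section SubmultiplicativeBound.
Variables (K : numFieldType) (A : falgType K).

(** In the l1-norm of the coordinates, multiplication by [h] has norm at most the
    [r] below. What matters is that this growth rate is the same for every
    [phi], only the constant [B] depending on it. *)
Lemma expr_coord_bound (h : A) : exists2 r : K, 0 < r &
  forall phi : {scalar A}, exists B : K, forall n, `|phi (h ^+ n)| <= B * r ^+ n.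
Proof.
pose e (i : 'I_(\dim {:A})) := (vbasis {:A})`_i.
pose N x : K := \sum_i `|coord (vbasis {:A}) i x|.
have xE x : x = \sum_i coord (vbasis {:A}) i x *: e i := coord_vbasis (memvf x).
have N0 x : 0 <= N x by apply: sumr_ge0.
have leN x i : `|coord (vbasis {:A}) i x| <= N x.
  by rewrite /N (bigD1 i) //= lerDl sumr_ge0.
pose r := 1 + \sum_i N (h * e i).
have r0 : 0 < r by rewrite ltr_wpDr // sumr_ge0.
exists r => // phi.
have Nh x : N (h * x) <= r * N x.
  rewrite {1}(xE x) mulr_sumr.
  apply: (@le_trans _ _ (\sum_i `|coord (vbasis {:A}) i x| * N (h * e i))).
    rewrite {1}/N; under [leRHS]eq_bigr do rewrite mulr_sumr.
    rewrite exchange_big /=; apply: ler_sum => j _.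
    rewrite linear_sum; apply: le_trans (ler_norm_sum _ _ _) _.
    by apply: ler_sum => i _; rewrite -scalerAr linearZ normrM.
  apply: (@le_trans _ _ ((\sum_i N (h * e i)) * N x)).
    by rewrite mulr_suml; apply: ler_sum => i _; rewrite mulrC ler_wpM2l.
  by rewrite ler_wpM2r // /r lerDr.
have Nhn n : N (h ^+ n) <= r ^+ n * N 1.
  elim: n => [|n IHn]; first by rewrite !expr0 mul1r.
  by rewrite !exprS -mulrA (le_trans (Nh _)) // ler_wpM2l // ltW.
exists ((\sum_i `|phi (e i)|) * N 1) => n.
rewrite -mulrA [N 1 * _]mulrC {1}(xE (h ^+ n)) linear_sum mulr_suml.
apply: le_trans (ler_norm_sum _ _ _) _; apply: ler_sum => i _.
rewrite linearZ /= normrM mulrC ler_wpM2l //.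
exact: le_trans (leN _ _) (Nhn n).
Qed.

End SubmultiplicativeBound.

Section PositiveFunctional.
Variables (R : realType) (A : finCstarAlg R).
Implicit Types (phi : {scalar A}) (f h x y : A).

Definition positive_functional phi := forall f, 0 <= phi (star f * f).

Lemma star1 : star (1 : A) = 1.
Proof. by have := starM (star (1 : A)) 1; rewrite mulr1 starK mulr1. Qed.

Lemma starX f n : star (f ^+ n) = star f ^+ n.
Proof.
by elim: n => [|n IHn]; rewrite ?expr0 ?star1 // exprS starM IHn -exprSr.
Qed.

Lemma star_sum I (r : seq I) (F : I -> A) :
  star (\sum_(i <- r) F i) = \sum_(i <- r) star (F i).
Proof. exact: (big_morph _ (@starD R A) (@star0 R A)). Qed.

(** Polarization: positivity makes [phi] real on [star x * x], and expanding this
    for [x = a + h] with [a = 1] and [a = i] gives the real and the imaginary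
    part of the identity. *)
Lemma positive_star phi h : positive_functional phi -> phi (star h) = (phi h)^*%C.
Proof.
move=> pos.
have phiZ c x : phi (c *: x) = c * phi x by exact: linearZ.
have cross_real (a : R[i]) : a^*%C * phi h + a * phi (star h) \is Num.real.
  have -> : a^*%C * phi h + a * phi (star h) =
      phi (star (a *: 1 + h) * (a *: 1 + h))
        - phi (star (a *: 1) * (a *: 1)) - phi (star h * h).
    rewrite !starD !starZ star1 mulrDr !mulrDl -!scalerAl !mul1r -!scalerAr mulr1.
    by rewrite !raddfD /= !phiZ; ring.
  by rewrite !rpredB ?ger0_real.
have z1 := cross_real 1; have zi := cross_real 'i%C.
move: z1 zi; move: (phi h) (phi (star h)) => [a b] [c d].
rewrite !complex_real; simpc => /eqP H1 /eqP H2.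
by apply/eqP; rewrite eq_complex /=; apply/andP; split; apply/eqP; lra.
Qed.

(** Positivity at [h - phi h], the vector minimizing [phi (star x * x)] over the
    translates [x] of [h] by scalars. *)
Lemma state_cauchy_schwarz phi h : positive_functional phi -> phi 1 = 1 ->
  `|phi h| ^+ 2 <= phi (star h * h).
Proof.
move=> pos phi1; set t := phi h.
have phiZ c x : phi (c *: x) = c * phi x by exact: linearZ.
have := pos (h + (- t) *: 1).
rewrite starD starZ star1 mulrDr !mulrDl -!scalerAl !mul1r -!scalerAr !mulr1.
rewrite !raddfD /= !phiZ phi1 (positive_star _ pos) -/t => H.
rewrite -subr_ge0 sqr_normc; congr (0 <= _): H; rewrite rmorphN /=; ring.
Qed.

Lemma state_pow2 phi h n : positive_functional phi -> phi 1 = 1 ->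
  star h = h -> 0 <= phi h ->
  phi h ^+ (2 ^ n) <= phi (h ^+ (2 ^ n)).
Proof.
move=> pos phi1 sh h0; elim: n => [|n IHn]; first by rewrite !expr1.
have g0 : 0 <= phi h ^+ (2 ^ n) by rewrite exprn_ge0.
rewrite expnS mulnC !exprM.
apply: (@le_trans _ _ (phi (h ^+ (2 ^ n)) ^+ 2)).
  by rewrite lerXn2r // nnegrE // (le_trans g0).
have := state_cauchy_schwarz (h ^+ (2 ^ n)) pos phi1.
by rewrite starX sh -expr2 ger0_norm // (le_trans g0).
Qed.

(** Iterating Cauchy-Schwarz on the self-adjoint [h = star f * f] gives
    [phi h ^ (2 ^ n) <= phi (h ^ (2 ^ n)) <= B * r ^ (2 ^ n)] with [r] independent
    of [phi]; taking [2 ^ n]-th roots makes the constant [B] disappear and leaves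
    [phi h <= r]. *)
Lemma states_bounded f : exists r : R[i],
  forall phi, positive_functional phi -> phi 1 = 1 -> `|phi f| <= r.
Proof.
have [r r0 rP] := expr_coord_bound (star f * f).
exists (1 + r) => phi pos phi1.
have [B BP] := rP phi.
have fr : phi (star f * f) <= r.
  rewrite -[leRHS]mul1r -ler_pdivrMr //; apply: (@bounded_powers_le1 _ _ B).
    by rewrite divr_ge0 // ltW.
  move=> n; rewrite expr_div_n ler_pdivrMr ?exprn_gt0 //.
  have H : phi (star f * f) ^+ (2 ^ n) <= phi ((star f * f) ^+ (2 ^ n)).
    by apply: state_pow2 => //; rewrite starM starK.
  apply: le_trans (H) _; apply: le_trans (BP _); apply: real_ler_norm.
  by rewrite ger0_real // (le_trans _ H) // exprn_ge0.
have r1 : 0 <= 1 + r by rewrite addr_ge0 // ltW.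
rewrite -(ler_pXn2r (ltn0Sn 1)) ?nnegrE //.
apply: le_trans (state_cauchy_schwarz _ pos phi1) _.
apply: le_trans fr _; rewrite -subr_ge0.
have -> : (1 + r) ^+ 2 - r = 1 + r + r ^+ 2 by ring.
by rewrite addr_ge0 // exprn_ge0 // ltW.
Qed.

End PositiveFunctional.

(** * Products and convolutions of states *)

Section Gram.
Variables (C : numClosedFieldType) (n : nat).
Local Open Scope sesquilinear_scope.

Lemma psd_diagonalization (P : 'M[C]_n) :
    (forall j k, P j k = Num.conj (P k j)) ->
    (forall u : 'I_n -> C, 0 <= \sum_j \sum_k Num.conj (u j) * u k * P j k) ->
  exists2 d : 'I_n -> C, (forall l, 0 <= d l) &
    exists U : 'M[C]_n, forall j k,
      P j k = \sum_l d l * (Num.conj (U l j) * U l k).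
Proof.
move=> herm psd.
have Pn : P \is normalmx.
  apply: hermitian_normalmx; apply/is_hermitianmxP; apply/matrixP => j k.
  by rewrite expr0 scale1r !mxE.
have PE := orthomx_spectralP Pn.
set U := spectralmx P in PE; set d := spectral_diag P in PE.
have Uu : U \is unitarymx := spectral_unitarymx P.
rewrite invmx_unitary // in PE.
have dE : diag_mx d = U *m P *m U ^t*.
  rewrite {1}PE !mulmxA (unitarymxP Uu) mul1mx.
  by rewrite -mulmxA (unitarymxP Uu) mulmx1.
exists (fun l => d 0 l) => [l|].
  have -> : d 0 l = \sum_j \sum_k
      Num.conj (Num.conj (U l j)) * Num.conj (U l k) * P j k.
    have -> : d 0 l = diag_mx d l l by rewrite mxE eqxx.
    rewrite dE mxE exchange_big /=; apply: eq_bigr => k _.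
    rewrite !mxE mulr_suml; apply: eq_bigr => j _; rewrite conjCK; ring.
  exact: (psd (fun k => Num.conj (U l k))).
exists U => j k; rewrite {1}PE mxE; apply: eq_bigr => l _.
rewrite mul_mx_diag !mxE; ring.
Qed.

End Gram.

Section PureSums.
Variables (K : fieldType) (A B : vectType K).

Lemma pure_columns (X : tens A B) :
  exists x : 'I_(\dim {:B}) -> A, X = \sum_j x j *t (vbasis {:B})`_j.
Proof.
exists (fun j => \sum_i (X : 'M_(_, _)) i j *: (vbasis {:A})`_i).
rewrite [LHS]tens_expand /tlift exchange_big; apply: eq_bigr => j _ /=.
pose pl := HB.pack_for {linear A -> tens A B} ((@pure _ A B)^~ (vbasis {:B})`_j)
  (GRing.isLinear.Build _ _ _ _ _ (pure_linearl (vbasis {:B})`_j)).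
rewrite [RHS](linear_sum pl); apply: eq_bigr => i _.
by rewrite (linearZZ pl).
Qed.

End PureSums.

Section ProductFunctional.
Variables (R : realType) (A : finCstarAlg R).
Implicit Types (mu nu : {scalar A}) (X : tens A A).

Lemma tstar_sum I (r : seq I) (F : I -> tens A A) :
  tstar (\sum_(i <- r) F i) = \sum_(i <- r) tstar (F i).
Proof.
have tD : {morph @tstar R A A : X Y / X + Y}.
  by move=> X Y; rewrite /tstar -raddfD /= map_mxD.
have t0 : tstar (0 : tens A A) = 0.
  by apply: (addIr (tstar (0 : tens A A))); rewrite -tD !add0r.
exact: (big_morph _ tD t0).
Qed.

Definition product_functional mu nu : tens A A -> R[i]^o :=
  tlift (fun x y => mu x * nu y : R[i]^o).

Lemma product_functional_pure mu nu x y :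
  product_functional mu nu (x *t y) = mu x * nu y.
Proof.
rewrite /product_functional tlift_pure // => [y'|x'] c u v.
  by rewrite linearP mulrDl -mulrA.
by rewrite linearP mulrDr mulrCA.
Qed.

(** A Schur product argument. With [X = \sum_j x_j *t e_j], the value is the sum of
    [mu (star x_j * x_k) * nu (star e_j * e_k)]; diagonalizing the Gram matrix of
    [nu] turns it into a combination, with nonnegative weights [d_l], of the
    numbers [mu (star z_l * z_l)] where [z_l = \sum_k U_lk x_k]. *)
Lemma product_functional_positive mu nu X :
  positive_functional mu -> positive_functional nu ->
  0 <= product_functional mu nu (tstar X * X).
Proof.
move=> mupos nupos; have [x ->] := pure_columns X.
set e := fun j : 'I_(\dim {:A}) => (vbasis {:A})`_j.
pose P : 'M[R[i]]_(\dim {:A}) := \matrix_(j, k) nu (star (e j) * e k).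
have herm j k : P j k = Num.conj (P k j).
  by rewrite !mxE -[RHS](positive_star _ nupos) starM starK.
have psd (u : 'I_(\dim {:A}) -> R[i]) :
    0 <= \sum_j \sum_k Num.conj (u j) * u k * P j k.
  have := nupos (\sum_k u k *: e k).
  rewrite star_sum big_distrlr /= linear_sum.
  congr (0 <= _); apply: eq_bigr => j _; rewrite linear_sum.
  apply: eq_bigr => k _.
  by rewrite starZ -scalerAl -scalerAr !linearZ /= mxE mulrA.
have [d d0 [U PE]] := psd_diagonalization herm psd.
rewrite tstar_sum big_distrlr /=.
have -> : product_functional mu nu
    (\sum_i \sum_j tstar (x i *t (vbasis {:A})`_i) * (x j *t (vbasis {:A})`_j)) =
  \sum_j \sum_k mu (star (x j) * x k) * P j k.
  rewrite /product_functional linear_sum; apply: eq_bigr => j _.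
  rewrite linear_sum; apply: eq_bigr => k _.
  rewrite tstar_pure tensM mxE; exact: product_functional_pure.
have -> : \sum_j \sum_k mu (star (x j) * x k) * P j k =
    \sum_l d l * mu (star (\sum_k U l k *: x k) * (\sum_k U l k *: x k)).
  under eq_bigr do under eq_bigr do rewrite PE mulr_sumr.
  under eq_bigr do rewrite exchange_big.
  rewrite exchange_big; apply: eq_bigr => l _.
  rewrite star_sum big_distrlr /= linear_sum mulr_sumr.
  apply: eq_bigr => j _; rewrite linear_sum mulr_sumr; apply: eq_bigr => k _.
  rewrite mulrCA; congr (_ * _).
  rewrite starZ -scalerAl -[star _ * (_ *: _)]scalerAr.
  by rewrite [RHS]linearZ /= [mu (_ *: _)]linearZ /= mulrC mulrA.
by apply: sumr_ge0 => l _; rewrite mulr_ge0.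
Qed.

End ProductFunctional.

Section ConvolutionStates.
Variables (R : realType) (G : finQuantumGroup R).
Implicit Types (f eta : G) (mu nu phi : {scalar G}).

Lemma conv_state mu nu :
  is_state mu -> is_state nu -> is_state (conv mu nu : {scalar G}).
Proof.
move=> [mupos mu1] [nupos nu1]; split=> [f|].
  by rewrite /= /conv rmorphM /= comult_star product_functional_positive.
rewrite /= /conv rmorph1 -[tlift _]/(product_functional mu nu) tens1.
by rewrite product_functional_pure mu1 nu1 mulr1.
Qed.

(** The Haar element forces the counit to commute with the involution: both
    [counit (star f)] and the conjugate of [counit f] are the scalar by which
    [star f] acts on the self-adjoint central [eta]. *)
Lemma counit_state eta : is_haar_element eta -> is_state (counit G : {scalar G}).
Proof.
move=> heta; have e1 := haar_counit heta.
have cstar f : counit G (star f) = (counit G f)^*%C.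
  have : counit G (star f) *: eta = (counit G f)^*%C *: eta.
    have etaS := (haar_projection heta).1.
    rewrite -(haar_absorb _ heta) (haar_central heta) -{1}etaS -starM.
    by rewrite (haar_absorb _ heta) starZ etaS.
  move/(congr1 (counit G)); rewrite !linearZ /= e1 !mulr1; exact.
split=> [f|]; last exact: rmorph1.
by rewrite /= rmorphM /= cstar mulrC -sqr_normc exprn_ge0.
Qed.

Definition conv_op nu f : G := tlift (fun x y => nu x *: y) (comult G f).

Fact conv_op_is_linear nu : linear (conv_op nu).
Proof. by move=> c f g; rewrite /conv_op !linearP. Qed.
HB.instance Definition _ nu :=
  GRing.isLinear.Build R[i] G G *:%R (conv_op nu) (conv_op_is_linear nu).

Lemma conv_opE nu phi f : phi (conv_op nu f) = conv nu phi f.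
Proof.
rewrite /conv_op /conv /tlift linear_sum; apply: eq_bigr => i _.
by rewrite linear_sum; apply: eq_bigr => j _; rewrite linearZ /= linearZ.
Qed.

(** The case [k = 1] is the counit axiom. Then one argues by induction: composing
    a functional with [conv_op nu] convolves it with [nu] on the left, which is
    how [conv_pow] proceeds. *)
Lemma conv_powE nu k f : conv_pow nu k f = counit G (iter k (conv_op nu) f).
Proof.
case: k => // k; elim: k f => [|k IHk] f.
  rewrite /= (conv_opE nu (counit G : {scalar G})) -[in LHS](counit_comultr f).
  rewrite /conv /tlift linear_sum; apply: eq_bigr => i _.
  rewrite linear_sum; apply: eq_bigr => j _; rewrite linearZ /= linearZ.
  by congr (_ * _); exact: mulrC.
by rewrite iterSr -IHk conv_opE.
Qed.

Lemma conv_pow_state nu k : is_state (counit G : {scalar G}) -> is_state nu ->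
  is_state (conv_pow nu k).
Proof.
move=> eps_state nu_state; case: k => // k; elim: k => //= k IHk.
exact: conv_state.
Qed.

(** The key use of [0 < nu eta]. On [g = star f * f], the difference
    [nu g - nu eta * counit g] is [nu (g * (1 - eta))], and [1 - eta] is a central
    projection. *)
Lemma state_sub_counit nu eta : is_haar_element eta -> is_state nu ->
  0 < nu eta -> exists c : R[i], exists2 psi : {scalar G},
    0 < c < 1 & is_state psi /\ forall f, nu f = c * counit G f + (1 - c) * psi f.
Proof.
move=> heta [nupos nu1] nueta.
have eps_state := counit_state heta.
have le_nu f : nu eta * counit G (star f * f) <= nu (star f * f).
  set g := star f * f.
  have gE : nu g - nu eta * counit G g = nu (star (f * (1 - eta)) * (f * (1 - eta))).
    have sE : star (1 - eta) = 1 - eta.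
      by rewrite -scaleN1r starD starZ star1 (haar_projection heta).1 rmorphN1.
    have cE (h : G) : (1 - eta) * h = h * (1 - eta).
      by rewrite mulrBl mulrBr mul1r mulr1 (haar_central heta).
    have idem : (1 - eta) * (1 - eta) = 1 - eta.
      by rewrite mulrBr mulr1 mulrBl mul1r (haar_projection heta).2 subrr subr0.
    rewrite starM sE -mulrA (mulrA (star f)) -/g mulrA cE -mulrA idem.
    rewrite mulrBr mulr1 (haar_absorb _ heta) raddfB /= [nu eta * _]mulrC.
    by rewrite [in RHS]linearZ.
  by rewrite -subr_ge0 gE.
have le1 : nu eta <= 1.
  have := le_nu 1; rewrite star1 mulr1 nu1.
  by rewrite [counit G 1]rmorph1 mulr1.
(* Half of [nu eta], so that [1 - c] is invertible even when [nu eta = 1]. *)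
pose c := nu eta / 2.
have c0 : 0 < c by rewrite divr_gt0.
have c1 : c < 1.
  rewrite ltr_pdivrMr // mul1r; apply: le_lt_trans le1 _.
  by rewrite ltr1n.
have p0 : 0 < 1 - c by rewrite subr_gt0.
pose psi f : R[i] := (1 - c)^-1 * (nu f - c * counit G f).
have psi_lin : linear_for *%R psi.
  by move=> a f g; rewrite /psi !linearP /=; ring.
pose psi' : {scalar G} := HB.pack psi (GRing.isLinear.Build _ _ _ _ psi psi_lin).
exists c; exists psi'; first by rewrite c0 c1.
split; last first.
  by move=> f /=; rewrite /psi mulVKf ?lt0r_neq0 // addrC subrK.
split=> [f|] /=; rewrite /psi; last first.
  by rewrite nu1 [counit G 1]rmorph1 mulr1 mulVf ?lt0r_neq0.
rewrite mulr_ge0 ?invr_ge0 ?(ltW p0) // subr_ge0.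
apply: le_trans (le_nu f); apply: ler_wpM2r; first exact: eps_state.1.
by rewrite ler_pdivrMr // ler_peMr ?ltW // ltr1n.
Qed.

Lemma conv_pow_cvg nu eta f : is_haar_element eta -> is_state nu -> 0 < nu eta ->
  exists l : R[i]^o, ((conv_pow nu k f : R[i]^o) @[k --> \oo] --> l)%classic.
Proof.
move=> heta nu_state nueta; have eps_state := counit_state heta.
have [c [psi /andP[c0 c1] [psi_state nuE]]] := state_sub_counit heta nu_state nueta.
pose eps : {linear G -> R[i]^o} := HB.pack (counit G : G -> R[i]^o)
  (GRing.isLinear.Build R[i] G R[i]^o *:%R (counit G : G -> R[i]^o)
     (linearP (counit G : {scalar G}))).
have powE k : (conv_pow nu k f : R[i]^o) = eps (iter k (conv_op nu) f).
  exact: conv_powE.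
rewrite (_ : (fun k => _) = fun k => eps (iter k (conv_op nu) f)); last exact/funext.
(* The walk stays put with probability [c], so it moves with [1 - c]. *)
have opE x : conv_op nu x = (1 - (1 - c)) *: x + (1 - c) *: conv_op psi x.
  rewrite subKr -{2}[x]counit_comultl /conv_op /tlift !scaler_sumr -big_split.
  apply: eq_bigr => i _; rewrite !scaler_sumr -big_split; apply: eq_bigr => j _ /=.
  rewrite nuE !scalerA -scalerDl; congr (_ *: _); ring.
have [r rP] := states_bounded f.
have p01 : 0 < 1 - c < 1 by rewrite subr_gt0 c1 gtrBl.
apply: cvg_orbit; apply: cvg0_of_sqr_le_harmonic => n.
apply: (lazy_orbit_diff (phi := counit G : {scalar G}) opE (r := r) n p01) => k.
have [pos one] := conv_pow_state k eps_state psi_state.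
by have := rP _ pos one; rewrite conv_powE.
Qed.

End ConvolutionStates.

(** * The limit functional *)

Theorem theorem5p1 (R : realType) (G : finQuantumGroup R) (eta : G)
    (nu : {scalar G}) :
  is_haar_element eta -> is_state nu -> 0 < nu eta ->
  exists mu : {scalar G}, dual_cvg (conv_pow nu) mu.
Proof.
move=> heta nu_state nueta.
have /choice[mu muP] f := conv_pow_cvg f heta nu_state nueta.
have mu_lin : linear_for *%R (mu : G -> R[i]).
  move=> c f g; apply: (@norm_cvg_unique _ R[i]^o _ _ _ _ (muP _)).
  have E k : (conv_pow nu k (c *: f + g) : R[i]^o) =
      c *: (conv_pow nu k f : R[i]^o) + conv_pow nu k g by rewrite linearP.
  rewrite (_ : (fun k => _) = fun k => c *: (conv_pow nu k f : R[i]^o)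
      + conv_pow nu k g); last exact/funext.
  by apply: cvgD (muP g); apply: cvgZr.
pose mu' : {scalar G} := HB.pack (mu : G -> R[i])
  (GRing.isLinear.Build _ _ _ _ (mu : G -> R[i]) mu_lin).
by exists mu'.
Qed.
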